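(* Let $(\chi,\mu)$ be a $\sigma$-finite measure space and let $q,r\in\Omega$ be probability densities with respect to $\mu$. Then for all $-\infty\le u<s\le\infty$, $$1-\tfrac12 D_v(r,q)\ \le\ D_{L_u}(r,q)\ \le\ D_{L_s}(r,q)\ \le\ 1+\tfrac12 D_v(r,q).$$ In particular, for all $p,q\in\Omega$, $$1-\tfrac12 D_v(p,q)\le D_{[HG^2]^{1/3}}(p,q)\le D_B(p,q)\le D_L(p,q)\le \tfrac12+\tfrac12 D_B(p,q)\le D_I(p,q)\le 1 .$$
   Context: $\Omega$ is the set of measurable functions $p:\chi\to\mathbb{R}$ with $p(x)\ge 0$ and $\int_\chi p\,d\mu=1$. For $a,b>0$, $a\neq b$, the $t$-logarithmic mean is $$L_t(a,b)=\left[\frac{b^{t+1}-a^{t+1}}{(t+1)(b-a)}\right]^{1/t}\ (t\in\mathbb{R},\ t\ne -1,0),\qquad L_{-1}(a,b)=\frac{b-a}{\ln b-\ln a},\qquad L_0(a,b)=\frac1e\left(\frac{b^b}{a^a}\right)^{\frac1{b-a}},$$ with $L_t(a,a)=a$, and $L_{\infty}(a,b)=\max\{a,b\}$, $L_{-\infty}(a,b)=\min\{a,b\}$. Each $L_t$ is extended to $[0,\infty)^2$ by continuity. The $L_t$-divergence measure, for $t\in[-\infty,\infty]$, is $D_{L_t}(q,r)=\int_\chi L_t(q(x),r(x))\,d\mu(x)$. The variation distance is $D_v(p,q)=\int_\chi|p(x)-q(x)|\,d\mu(x)$. The Bhattacharyya distance is $D_B(p,q)=\int_\chi\sqrt{p(x)q(x)}\,d\mu(x)$.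 The logarithmic divergence is $D_L=D_{L_{-1}}$ and the identric divergence is $D_I=D_{L_0}$. Finally, $$D_{[HG^2]^{1/3}}(p,q)=\sqrt[3]{2}\int_\chi\frac{p^{2/3}(x)q^{2/3}(x)}{[p(x)+q(x)]^{1/3}}\,d\mu(x),$$ where the integrand is taken to be $0$ at points where $p(x)=q(x)=0$. *)

(* Defs.v *)
From HB Require Import structures.
From mathcomp Require Import all_boot all_order all_algebra.
From mathcomp Require Import all_classical all_reals all_analysis.

Set Implicit Arguments.
Unset Strict Implicit.
Unset Printing Implicit Defensive.

Import Order.TTheory GRing.Theory Num.Theory.
Import numFieldNormedType.Exports.

Local Open Scope classical_set_scope.
Local Open Scope ring_scope.

Section LogMean.
Context {R : realType}.

(* Only meaningful for a, b > 0. *)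
Definition logmean_pos (t : \bar R) (a b : R) : R :=
  match t with
  | +oo%E => Num.max a b
  | -oo%E => Num.min a b
  | s%:E =>
      if a == b then a
      else if s == -1 then (b - a) / (ln b - ln a)
      else if s == 0 then (expR 1)^-1 * ((b `^ b) / (a `^ a)) `^ (b - a)^-1
      else ((b `^ (s + 1) - a `^ (s + 1)) / ((s + 1) * (b - a))) `^ s^-1
  end.

(* Extension by continuity to the closed quadrant: when a = 0 or b = 0 the
   value is the limit at (a, b) along the open quadrant.  Nothing is intended
   for negative arguments. *)
Definition logmean (t : \bar R) (a b : R) : R :=
  if (0 < a) && (0 < b) then logmean_pos t a b
  else lim ((fun z : R * R => logmean_pos t z.1 z.2)
              @ within [set z : R * R | 0 < z.1 /\ 0 < z.2] (nbhs (a, b))).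

End LogMean.

Section Divergences.
Context {d : measure_display} {T : measurableType d} {R : realType}.
Variable mu : {measure set T -> \bar R}.
Local Open Scope ereal_scope.

Definition Omega : set (T -> R) :=
  [set p : T -> R | [/\ measurable_fun [set: T] p,
               forall x, (0 <= p x)%R &
               \int[mu]_x (p x)%:E = 1]].

Definition D_logmean (t : \bar R) (q r : T -> R) : \bar R :=
  \int[mu]_x (logmean t (q x) (r x))%:E.

Definition D_v (p q : T -> R) : \bar R := \int[mu]_x (`|p x - q x|%R)%:E.

Definition D_B (p q : T -> R) : \bar R :=
  \int[mu]_x (Num.sqrt (p x * q x))%:E.

Definition D_L (p q : T -> R) : \bar R := D_logmean (-1)%:E p q.

Definition D_I (p q : T -> R) : \bar R := D_logmean 0%:E p q.

(* Where p x = q x = 0 the integrand is 0, since 0 `^ (2/3) = 0 and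
   0^-1 = 0. *)
Definition D_HG2 (p q : T -> R) : \bar R :=
  (2 `^ 3^-1)%:E *
  \int[mu]_x (p x `^ (2 / 3) * q x `^ (2 / 3) / (p x + q x) `^ 3^-1)%:E.

End Divergences.

(* Main.v *)
(* For 0 < a < b the mean value theorem identifies L_t(a,b) with the c in
   ]a,b[ at which g_t, an antiderivative of x^(t-1), equals its average over
   [a,b].  Comparing derivatives gives, for u <= s,
   c^(-u) (g_u(x) - g_u(c)) <= c^(-s) (g_s(x) - g_s(c)); averaging this over x
   with c = L_u(a,b) yields L_u <= L_s.  The inequality survives on the axes
   because all the limits there exist.  Integrating against mu, the extreme
   cases t = -oo, +oo are the integrals of min and max, and G = L_(-2),
   L = L_(-1), (A + G)/2 = L_(-1/2), I = L_0 and A = L_1 form one increasing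
   chain. *)
Require Import Defs.
From HB Require Import structures.
From mathcomp Require Import all_boot all_order all_algebra.
From mathcomp Require Import all_classical all_reals all_analysis.
From mathcomp Require Import measurable_realfun ring lra.

Import Order.TTheory GRing.Theory Num.Theory.
Import numFieldNormedType.Exports.

Local Open Scope classical_set_scope.
Local Open Scope ring_scope.

(** * Antiderivatives of powers, and the mean as the point where an average is attained *)

Section Increments.
Context {R : realType}.
Implicit Types (f g : R -> R) (a b c t u s x : R).

Lemma mvt_pos f (df : R -> R) a b :
  (forall x, 0 < x -> is_derive x 1 f (df x)) -> 0 < a -> a < b ->
  exists2 c, a < c < b & f b - f a = df c * (b - a).
Proof.
move=> fdf a0 ab.
have [||c] := @MVT R f df a b ab; last by rewrite in_itv /=; exists c.
- by move=> x; rewrite in_itv /= => /andP[ax _]; apply/fdf/(lt_trans a0).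
- apply: derivable_within_continuous => x; rewrite in_itv /= => /andP[ax _].
  by have [] := fdf x (lt_le_trans a0 ax).
Qed.

(** The mean value theorem for [g - f] writes the difference of the two increments as a nonnegative
    derivative times [b - a]. *)
Lemma le_increment f g (df dg : R -> R) a b :
  (forall x, 0 < x -> is_derive x 1 f (df x)) ->
  (forall x, 0 < x -> is_derive x 1 g (dg x)) ->
  0 < a -> a <= b -> (forall x, a < x < b -> df x <= dg x) ->
  f b - f a <= g b - g a.
Proof.
move=> fdf gdg a0; rewrite le_eqVlt => /predU1P[-> _|ab fg].
  by rewrite !subrr.
have [|c acb] := @mvt_pos (g - f) (fun x => dg x - df x) _ _ _ a0 ab.
  move=> x x0; have := fdf _ x0; have := gdg _ x0 => ? ?.
  exact: is_deriveB.
rewrite -![(g - f) _]/(g _ - f _) => E.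
have : 0 <= (dg c - df c) * (b - a).
  by rewrite mulr_ge0 ?subr_ge0 ?fg// ltW.
rewrite -E; lra.
Qed.

(* [gen t] is an antiderivative of [x ^ (t - 1)], and the [t]-logarithmic mean
   of [a] and [b] is the point where [gen t] takes its average over [a, b]. *)
Definition gen t x : R := if t == 0 then ln x else t^-1 * x `^ t.

(** An antiderivative of [gen t]. The order [t = -1] needs no branch of its own, since [gen (t + 1)]
    is then the logarithm. *)
Definition gen_prim t x : R :=
  if t == 0 then x * ln x - x else t^-1 * gen (t + 1) x.

Lemma is_derive_gen t x : 0 < x -> is_derive x 1 (gen t) (x `^ (t - 1)).
Proof.
move=> x0; rewrite /gen; have [->|t0] := eqVneq t 0.
  by rewrite sub0r powR_inv1 ?ltW//; exact: is_derive1_ln.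
have h := is_derive1_powR t x0.
have := is_deriveZ (W := R^o) t^-1 h.
by rewrite /GRing.scale /= mulrA mulVf// mul1r.
Qed.

Lemma is_derive_gen_prim t x : 0 < x -> is_derive x 1 (gen_prim t) (gen t x).
Proof.
move=> x0; rewrite /gen_prim; have [->|t0] := eqVneq t 0.
  have h := is_derive1_ln x0.
  apply: is_derive_eq.
  rewrite /gen eqxx /GRing.scale /= divff ?gt_eqF// mulr1; ring.
have h := is_derive_gen (t + 1) _ x0.
have := is_deriveZ (W := R^o) t^-1 h.
have -> : gen t x = t^-1 * x `^ t by rewrite /gen (negbTE t0).
by rewrite addrK.
Qed.

Lemma gen_lt t x y : 0 < x -> x < y -> gen t x < gen t y.
Proof.
move=> x0 xy.
have [c /andP[xc cy] E] := mvt_pos (gen t) _ x y (is_derive_gen t) x0 xy.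
by rewrite -subr_gt0 E mulr_gt0 ?subr_gt0// powR_gt0// (lt_trans x0).
Qed.

Lemma gen_le t x y : 0 < x -> 0 < y -> (gen t x <= gen t y) = (x <= y).
Proof.
move=> x0 y0; case: (ltgtP x y) => [xy|yx|->]; last exact: lexx.
- by rewrite ltW// gen_lt.
- by rewrite leNgt gen_lt.
Qed.

(* Both sides vanish at [x = c], where the derivative in [x] of one is
   [(x / c) ^ u / x] and of the other [(x / c) ^ s / x]. *)
Lemma gen_tangent u s c x : u <= s -> 0 < c -> 0 < x ->
  c `^ (- u) * (gen u x - gen u c) <= c `^ (- s) * (gen s x - gen s c).
Proof.
move=> us c0 x0.
pose F t (z : R) : R := c `^ (- t) * gen t z.
have dF t (z : R) : 0 < z -> is_derive z 1 (F t) (c `^ (- t) * z `^ (t - 1)).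
  by move=> z0; exact: (is_deriveZ (W := R^o) _ (is_derive_gen t _ z0)).
have dFE t (z : R) : 0 < z -> c `^ (- t) * z `^ (t - 1) = (z / c) `^ t / z.
  move=> z0; rewrite powRM ?invr_ge0 ?ltW// powRB; last first.
    by rewrite (gt_eqF z0)/= implybT.
  rewrite powRr1 ?ltW// -(powR_inv1 (ltW c0)) -powRrM mulN1r; ring.
rewrite !mulrBr.
have [cx|/ltW xc] := leP c x.
  apply: (le_increment (F u) (F s) _ _ _ _ (dF u) (dF s)) => // z /andP[cz _].
  have z0 := lt_trans c0 cz.
  rewrite !dFE// ler_pM2r ?invr_gt0// ler_powR// ler_pdivlMr// mul1r; exact: ltW.
(* To the left of [c] the base [z / c] is below 1, which reverses the order of the powers; negating
   both sides compensates for this. *)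
rewrite -lerN2 !opprB.
apply: (le_increment (F s) (F u) _ _ _ _ (dF s) (dF u)) => // z /andP[xz zc].
have z0 := lt_trans x0 xz.
rewrite !dFE// ler_pM2r ?invr_gt0// ger_powR// divr_gt0//=.
by rewrite ler_pdivrMr// mul1r ltW.
Qed.

(** The mean value theorem for [gen_prim t] supplies [c]. Solving its equation for [c], separately
    for [t = -1], [t = 0] and the other orders, gives the defining formula of the mean. *)
Lemma logmean_pos_gen t a b : 0 < a -> a < b ->
  exists2 c, a < c < b &
    logmean_pos t%:E a b = c /\ gen_prim t b - gen_prim t a = gen t c * (b - a).
Proof.
move=> a0 ab; have b0 := lt_trans a0 ab.
have [c acb E] := mvt_pos _ _ a b (is_derive_gen_prim t) a0 ab.
exists c => //; split=> //.
have /andP[/(lt_trans a0) c0 _] := acb.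
have ba : b - a != 0 by rewrite subr_eq0 gt_eqF.
rewrite /= lt_eqF//; move: E; rewrite /gen_prim /gen.
have [->|t1] := eqVneq t (-1).
  rewrite !(oppr_eq0, oner_eq0) addNr eqxx powR_inv1 ?ltW// invrN1 !mulN1r => E.
  have {}E : ln b - ln a = c^-1 * (b - a) by lra.
  by rewrite E invfM invrK mulrCA divff// mulr1.
have [_|t0] := eqVneq t 0 => E.
  rewrite -(lnK c0) -expRN /powR !gt_eqF ?divr_gt0 ?expR_gt0//.
  rewrite -expRB expRK -expRD.
  congr expR.
  have -> : ln c = (b * ln b - b - (a * ln a - a)) / (b - a) by rewrite E mulfK.
  by field.
have t10 : t + 1 != 0 by rewrite addr_eq0.
have -> : (b `^ (t + 1) - a `^ (t + 1)) / ((t + 1) * (b - a)) = c `^ t.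
  rewrite (negbTE t10) in E.
  apply: (mulfI (invr_neq0 t0)); apply: (mulIf ba); rewrite -E.
  by field; rewrite t0 t10.
by rewrite -powRrM divff// powRr1// ltW.
Qed.

(** A swap negates numerator and denominator alike; in the identric case it inverts the base and
    negates the exponent. This allows the assumption [a <= b] later. *)
Lemma logmean_pos_sym (t : \bar R) a b : 0 < a -> 0 < b ->
  logmean_pos t a b = logmean_pos t b a.
Proof.
move=> a0 b0; case: t => [t| |] /=; [|exact: maxC|exact: minC].
rewrite eq_sym; case: eqVneq => // ab.
case: ifP => [_|_]; first by rewrite -mulrNN -invrN !opprB.
case: ifP => [_|_].
  rewrite -(opprB a b) invrN powRN -[a `^ a / _]invf_div.
  by rewrite -[(b `^ b / a `^ a)^-1]powR_inv1 ?divr_ge0 ?powR_ge0//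
    -powRrM mulN1r powRN.
congr (_ `^ _).
by rewrite -[in LHS]mulrNN -invrN -mulrN !opprB.
Qed.

End Increments.

(** * Monotonicity in the order for positive arguments *)

Section LogMeanOrder.
Context {R : realType}.
Implicit Types (a b x : R) (t u s : \bar R).

Lemma logmean_pos_bounds t a b : 0 < a -> 0 < b ->
  Num.min a b <= logmean_pos t a b <= Num.max a b.
Proof.
have le_minmax x y : Num.min x y <= Num.max x y :> R.
  by case: (leP x y) => [|/ltW].
case: t => [t| |] a0 b0; last 2 first.
- by rewrite /= le_minmax lexx.
- by rewrite /= le_minmax lexx.
wlog ab : a b a0 b0 / a <= b => [hw|].
  have /orP[ab|ba] := le_total a b; first exact: hw.
  by rewrite logmean_pos_sym// minC maxC; exact: hw.
rewrite min_l// max_r//; move: ab; rewrite le_eqVlt => /predU1P[->|ab].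
  by rewrite /= eqxx lexx.
by have [c /andP[ac cb] [-> _]] := logmean_pos_gen t a b a0 ab; rewrite !ltW.
Qed.

Lemma logmean_pos_le u s a b : (u <= s)%E -> 0 < a -> 0 < b ->
  logmean_pos u a b <= logmean_pos s a b.
Proof.
move=> us a0 b0.
have le_max v : logmean_pos v a b <= Num.max a b.
  by have /andP[] := logmean_pos_bounds v a b a0 b0.
have ge_min v : Num.min a b <= logmean_pos v a b.
  by have /andP[] := logmean_pos_bounds v a b a0 b0.
case: u us => [u| |]; last 2 first.
- by rewrite leye_eq => /eqP ->.
- by move=> _; exact: ge_min.
case: s => [s| |//]; last by move=> _; exact: le_max.
rewrite lee_fin => us {le_max ge_min}.
wlog ab : a b a0 b0 / a <= b => [hw|].
  have /orP[ab|ba] := le_total a b; first exact: hw.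
  by rewrite ![logmean_pos _ a b]logmean_pos_sym//; exact: hw.
move: ab; rewrite le_eqVlt => /predU1P[->|ab]; first by rewrite /= eqxx.
have [c /andP[ac _] [-> Ec]] := logmean_pos_gen u a b a0 ab.
have [e /andP[ae _] [-> Ee]] := logmean_pos_gen s a b a0 ab.
have c0 := lt_trans a0 ac; have e0 := lt_trans a0 ae.
(* Average [gen_tangent] at [c] over [a, b]: the left side averages to 0. *)
pose F v x : R := c `^ (- v) * (gen_prim v x - gen v c * x).
have dF v x : 0 < x -> is_derive x 1 (F v) (c `^ (- v) * (gen v x - gen v c)).
  move=> x0; apply: (is_deriveZ (W := R^o)).
  have h1 := is_derive_gen_prim v x x0.
  have h2 := is_deriveZ (W := R^o) (gen v c) (is_derive_id x (1 : R)).
  have := is_deriveB (W := R^o) h1 h2.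
  by rewrite /GRing.scale /= mulr1.
have := le_increment (F u) (F s) _ _ a b (dF u) (dF s) a0 (ltW ab).
have FE v : F v b - F v a =
    c `^ (- v) * (gen_prim v b - gen_prim v a - gen v c * (b - a)).
  by rewrite /F; ring.
(* The left increment vanishes by the choice of [c]. On the right the average of [gen s] is
   [gen s e], so what is left is [gen s c <= gen s e], that is [c <= e]. *)
rewrite !FE Ec Ee subrr mulr0 -mulrBl.
rewrite pmulr_rge0 ?powR_gt0// pmulr_lge0 ?subr_gt0// subr_ge0 gen_le//; apply.
by move=> x /andP[ax _]; apply: gen_tangent => //; exact: lt_trans ax.
Qed.

End LogMeanOrder.

(** * Limits on the boundary of the quadrant and closed forms up to it *)

Local Notation quadrant := [set z | 0 < z.1 /\ 0 < z.2].
Local Notation quad p := (within quadrant (nbhs p)).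

Section LogMeanLimit.
Context {R : realType}.
Implicit Types (a b x : R) (t u s : \bar R).

(** Shifting [(a, b)] by half the radius in both coordinates stays in the ball and enters the open
    quadrant. Properness makes the limits unique and compatible with the order. *)
Lemma quad_filter a b : 0 <= a -> 0 <= b -> ProperFilter (quad (a, b)).
Proof.
move=> a0 b0; apply: within_nbhs_proper => U /nbhs_ballP[e /= e0 eU].
exists (a + e / 2, b + e / 2); split; first by split => /=; lra.
by apply: eU; split; rewrite /ball /= opprD addrA subrr sub0r normrN
  gtr0_norm ?divr_gt0// ltr_pdivrMr// ltr_pMr// ltr1n.
Qed.

Lemma near_quad a b : \forall z \near quad (a, b), 0 < z.1 /\ 0 < z.2.
Proof. exact: near_withinT. Qed.

Lemma cvg_quad1 a b : z.1 @[z --> quad (a, b)] --> a.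
Proof. by apply: cvg_within_filter; exact: cvg_fst. Qed.

Lemma cvg_quad2 a b : z.2 @[z --> quad (a, b)] --> b.
Proof. by apply: cvg_within_filter; exact: cvg_snd. Qed.

(** The coordinate stays positive on the quadrant, so the one-sided limits of [ln] and of powers at
    0 can be composed with it. *)
Lemma cvg_quad1_right b : z.1 @[z --> quad (0 : R, b)] --> 0^'+.
Proof.
move=> A A0.
have := @cvg_quad1 0 b _ A0; rewrite !near_simpl => H.
by near=> z; apply: (near H z) => //; have [] := near (near_quad 0 b) z.
Unshelve. all: end_near. Qed.

(** Lying between minimum and maximum, the mean is squeezed between 0 and the sum of the
    coordinates. *)
Lemma logmean_pos_cvg00 t :
  logmean_pos t z.1 z.2 @[z --> quad (0 : R, 0 : R)] --> (0 : R).
Proof.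
have F := @quad_filter 0 0 (lexx _) (lexx _).
have h : z.1 + z.2 @[z --> quad (0 : R, 0 : R)] --> (0 : R).
  rewrite -[X in _ --> X]addr0; apply: cvgD; [exact: cvg_quad1|exact: cvg_quad2].
apply: (squeeze_cvgr _ (cvg_cst 0) h).
near=> z; have [z1 z2] : 0 < z.1 /\ 0 < z.2 by near: z; exact: near_quad.
have /andP[l r] := logmean_pos_bounds t _ _ z1 z2.
apply/andP; split; first by rewrite (le_trans _ l)// le_min !ltW.
by rewrite (le_trans r)// ge_max lerDl lerDr !ltW.
Unshelve. all: end_near. Qed.

(** * Limits at a point [(0, b)] with [b > 0] *)

Section axis.
Variable b : R.
Hypothesis b0 : 0 < b.
Let F := quad_filter 0 b (lexx _) (ltW b0).
#[local] Existing Instance F.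

Lemma near_axis : \forall z \near quad (0 : R, b),
  [/\ 0 < z.1, 0 < z.2 & z.1 < z.2].
Proof.
near=> z.
have [z1 z2] : 0 < z.1 /\ 0 < z.2 by near: z; exact: near_quad.
(* [b / 2] separates the coordinates, which tend to 0 and to [b]. *)
split=> //; apply: (@lt_trans _ _ (b / 2)); near: z.
  by apply: (cvgr_lt (0 : R) (cvg_quad1 0 b)); rewrite divr_gt0.
by apply: (cvgr_gt b (cvg_quad2 0 b)); rewrite ltr_pdivrMr// ltr_pMr// ltr1n.
Unshelve. all: end_near. Qed.

Lemma cvg_axis_diff : z.2 - z.1 @[z --> quad (0 : R, b)] --> b.
Proof.
rewrite -[X in _ --> X]subr0; apply: cvgB; [exact: cvg_quad2|exact: cvg_quad1].
Qed.

(** The numerator tends to [b] while the difference of logarithms tends to [+oo]. *)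
Lemma cvg_axis_log :
  logmean_pos (-1)%:E z.1 z.2 @[z --> quad (0 : R, b)] --> (0 : R).
Proof.
have dlny : ln z.2 - ln z.1 @[z --> quad (0 : R, b)] --> +oo.
  apply/cvgryPge => A; near=> z.
  have : ln z.1 <= ln b - 1 - A.
    near: z; move: (ln b - 1 - A); apply/cvgrNyPle.
    exact: (cvg_comp _ _ (cvg_quad1_right b) (@lnNy R)).
  have : ln b - 1 < ln z.2.
    near: z; apply: (cvgr_gt (ln b)); last by rewrite ltrBlDr ltrDl.
    exact: (continuous_cvg _ (continuous_ln b0) (cvg_quad2 0 b)).
  lra.
have dV : (ln z.2 - ln z.1)^-1 @[z --> quad (0 : R, b)] --> (0 : R).
  apply/gtr0_cvgV0 => //; near=> z.
  have [z1 z2 z12] : [/\ 0 < z.1, 0 < z.2 & z.1 < z.2].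
    by near: z; exact: near_axis.
  by rewrite subr_gt0 ltr_ln.
apply: cvg_trans (_ :
  (z.2 - z.1) * (ln z.2 - ln z.1)^-1 @[z --> quad (0 : R, b)] --> (0 : R)).
  apply: near_eq_cvg; near=> z.
  have [z1 z2 z12] : [/\ 0 < z.1, 0 < z.2 & z.1 < z.2].
    by near: z; exact: near_axis.
  by rewrite /= lt_eqF// eqxx.
by rewrite -[X in _ --> X](mulr0 b); apply: cvgM => //; exact: cvg_axis_diff.
Unshelve. all: end_near. Qed.

Lemma cvg_axis_identric : cvg (logmean_pos 0%:E z.1 z.2 @[z --> quad (0 : R, b)]).
Proof.
have xlnx : z.1 * ln z.1 @[z --> quad (0 : R, b)] --> (0 : R).
  (* With [w] the square root of [x = z.1], the bound [ln y <= y - 1] at [y = w^-1] gives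
     [2 * x - 2 * w <= x * ln x]; for [x < 1] the upper bound is 0. *)
  have h : 2 * z.1 - 2 * Num.sqrt z.1 @[z --> quad (0 : R, b)] --> (0 : R).
    rewrite -[X in _ --> X](subrr (2 * 0)) -[in X in _ - X](@sqrtr0 R).
    apply: cvgB; first by apply: cvgMr; exact: cvg_quad1.
    apply: cvgMr.
    exact: (continuous_cvg _ (@sqrt_continuous R 0) (cvg_quad1 0 b)).
  apply: (squeeze_cvgr _ h (cvg_cst 0)); near=> z.
  have [z1 _] : 0 < z.1 /\ 0 < z.2 by near: z; exact: near_quad.
  have z11 : z.1 < 1 by near: z; exact: (cvgr_lt (0 : R) (cvg_quad1 0 b)).
  apply/andP; split; last by rewrite pmulr_rle0// ln_le0// ltW.
  have s0 : 0 < Num.sqrt z.1 by rewrite sqrtr_gt0.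
  have := @le_ln1Dx _ ((Num.sqrt z.1)^-1 - 1).
  rewrite ltrBrDl subrr invr_gt0 => /(_ s0).
  rewrite addrC subrK lnV ?posrE// => lnw.
  rewrite -{1 3 4}(sqr_sqrtr (ltW z1)) lnXn//.
  move: (Num.sqrt z.1) s0 lnw => w w0 lnw.
  have -> : 2 * w ^+ 2 - 2 * w = w ^+ 2 * ((1 - w^-1) *+ 2).
    by field; rewrite gt_eqF.
  by rewrite ler_pM2l ?exprn_gt0// lerMn2r/= -lerN2 opprB.
pose g z : R := expR ((z.2 * ln z.2 - z.1 * ln z.1) / (z.2 - z.1) - 1).
(* The [0] is the limit of [z.1 * ln z.1]; the value equals [b] divided by [expR 1]. *)
apply/cvg_ex; exists (expR ((b * ln b - 0) / b - 1)).
apply: cvg_trans (_ : g z @[z --> quad (0 : R, b)] --> _).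
  apply: near_eq_cvg; near=> z.
  have [z1 z2 z12] : [/\ 0 < z.1, 0 < z.2 & z.1 < z.2].
    by near: z; exact: near_axis.
  rewrite /= lt_eqF// eq_sym oppr_eq0 oner_eq0 eqxx /g.
  rewrite -expRN /powR !gt_eqF ?divr_gt0 ?expR_gt0// -expRB expRK -expRD.
  by congr expR; ring.
apply: (continuous_cvg _ (@continuous_expR R _)).
apply: cvgB; last exact: cvg_cst.
apply: cvgM; last by apply: cvgV; [exact: lt0r_neq0|exact: cvg_axis_diff].
apply: cvgB => //; apply: cvgM; first exact: cvg_quad2.
exact: (continuous_cvg _ (continuous_ln b0) (cvg_quad2 0 b)).
Unshelve. all: end_near. Qed.

Lemma continuous_powR_pos r x : 0 < x -> {for x, continuous (@powR R ^~ r)}.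
Proof.
move=> x0; apply: differentiable_continuous; apply/derivable1_diffP.
by have [] := is_derive1_powR r x0.
Qed.

(** Since [t + 1 > 0], the power of the vanishing coordinate tends to 0. The base of the outer power
    then has a positive limit, where that power is continuous even for a negative exponent. *)
Lemma cvg_axis_power (t : R) : -1 < t -> t != 0 ->
  cvg (logmean_pos t%:E z.1 z.2 @[z --> quad (0 : R, b)]).
Proof.
move=> t1 t0; have t10 : 0 < t + 1 by rewrite -ltrBlDr sub0r.
pose g z : R :=
  ((z.2 `^ (t + 1) - z.1 `^ (t + 1)) / ((t + 1) * (z.2 - z.1))) `^ t^-1.
apply/cvg_ex; exists (((b `^ (t + 1) - 0) / ((t + 1) * b)) `^ t^-1).
apply: cvg_trans (_ : g z @[z --> quad (0 : R, b)] --> _).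
  apply: near_eq_cvg; near=> z.
  have [z1 z2 z12] : [/\ 0 < z.1, 0 < z.2 & z.1 < z.2].
    by near: z; exact: near_axis.
  by rewrite /= lt_eqF// (negbTE t0) gt_eqF.
apply: (continuous_cvg _ (continuous_powR_pos t^-1 _ _)).
  by rewrite subr0 divr_gt0 ?powR_gt0 ?mulr_gt0.
apply: cvgM.
  apply: cvgB.
    exact: (continuous_cvg _ (continuous_powR_pos _ _ b0) (cvg_quad2 0 b)).
  exact: (cvg_comp _ _ (cvg_quad1_right b) (powR_cvg0 t10)).
apply: cvgV; first by rewrite mulf_neq0 ?gt_eqF.
by apply: cvgMr; exact: cvg_axis_diff.
Unshelve. all: end_near. Qed.

Lemma cvg_axis t : cvg (logmean_pos t z.1 z.2 @[z --> quad (0 : R, b)]).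
Proof.
case: t => [t| |].
- have [->|t0] := eqVneq t 0; first exact: cvg_axis_identric.
  have [t1|t1] := ltP (-1) t; first exact: cvg_axis_power.
  (* For [t <= -1], monotonicity in the order squeezes the mean between 0 and the logarithmic mean,
     which tends to 0. *)
  apply/cvg_ex; exists 0.
  apply: (squeeze_cvgr _ (cvg_cst 0) cvg_axis_log); near=> z.
  have [z1 z2 z12] : [/\ 0 < z.1, 0 < z.2 & z.1 < z.2].
    by near: z; exact: near_axis.
  rewrite logmean_pos_le ?lee_fin// andbT.
  have /andP[l _] := logmean_pos_bounds t%:E _ _ z1 z2.
  by rewrite (le_trans _ l)// le_min !ltW.
- apply/cvg_ex; exists (Num.max 0 b); apply: cvg_within_filter.
  by apply: (@continuous_max _ _ fst snd (0, b)); [exact: cvg_fst|exact: cvg_snd].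
- apply/cvg_ex; exists (Num.min 0 b); apply: cvg_within_filter.
  by apply: (@continuous_min _ _ fst snd (0, b)); [exact: cvg_fst|exact: cvg_snd].
Unshelve. all: end_near. Qed.

End axis.

Lemma logmean_pos_is_cvg t a b : 0 <= a -> 0 <= b -> ~~ ((0 < a) && (0 < b)) ->
  cvg (logmean_pos t z.1 z.2 @[z --> quad (a, b)]).
Proof.
rewrite !le_eqVlt => /predU1P[<-|a0] /predU1P[<-|b0] //.
- by move=> _; apply/cvg_ex; exists 0; exact: logmean_pos_cvg00.
- by move=> _; exact: cvg_axis.
- move=> _; have /cvg_ex[l /= Hl] := cvg_axis a a0 t.
  (* Swapping coordinates carries the approach to [(a, 0)] into one to [(0, a)]; symmetry of the
     mean then transports the limit. *)
  have sw : (z.2, z.1) @[z --> quad (a, 0 : R)] `=>` quad (0 : R, a).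
    move=> A /= A0.
    have : (z.2, z.1) @[z --> quad (a, 0 : R)] --> (0 : R, a).
      exact: (cvg_pair (cvg_quad2 a 0) (cvg_quad1 a 0)).
    move=> /(_ _ A0) H; have N := near_quad a 0.
    by move: H N; rewrite !near_simpl; apply: filterS2 => z /= h [? ?]; exact: h.
  apply/cvg_ex; exists l; apply: cvg_trans (cvg_comp _ _ sw Hl).
  apply: near_eq_cvg; have := near_quad a 0; apply: filterS => z /= [z1 z2].
  by rewrite logmean_pos_sym.
- by rewrite a0 b0.
Qed.

Lemma logmean_le u s a b : (u <= s)%E -> 0 <= a -> 0 <= b ->
  logmean u a b <= logmean s a b.
Proof.
move=> us a0 b0; rewrite /logmean; case: ifPn => [/andP[a1 b1]|ab].
  exact: logmean_pos_le.
have F := quad_filter a b a0 b0.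
apply: ler_lim; [exact: logmean_pos_is_cvg|exact: logmean_pos_is_cvg|].
by have := near_quad a b; apply: filterS => z [? ?]; exact: logmean_pos_le.
Qed.

(** A closed form on the open quadrant that is continuous at a boundary point gives the limit there,
    hence the extended mean. All the special orders below are evaluated this way. *)
Lemma logmean_continuousE t (f : R * R -> R) a b : 0 <= a -> 0 <= b ->
  {for (a, b), continuous f} ->
  (forall x y, 0 < x -> 0 < y -> logmean_pos t x y = f (x, y)) ->
  logmean t a b = f (a, b).
Proof.
move=> a0 b0 cf tf; rewrite /logmean; case: ifPn => [/andP[a1 b1]|ab].
  exact: tf.
have F := quad_filter a b a0 b0.
apply: cvg_lim => //; apply: cvg_trans (cvg_within_filter _ cf).
apply: near_eq_cvg; have := near_quad a b; apply: filterS => -[x y] [? ?] /=.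
by rewrite tf.
Qed.

Lemma logmeanNy a b : 0 <= a -> 0 <= b -> logmean -oo a b = Num.min a b.
Proof.
move=> a0 b0; apply: (logmean_continuousE _ (fst \min snd)) => //.
by apply: continuous_min; [exact: cvg_fst|exact: cvg_snd].
Qed.

Lemma logmeany a b : 0 <= a -> 0 <= b -> logmean +oo a b = Num.max a b.
Proof.
move=> a0 b0; apply: (logmean_continuousE _ (fst \max snd)) => //.
by apply: continuous_max; [exact: cvg_fst|exact: cvg_snd].
Qed.

Lemma logmean_arithmetic a b : 0 <= a -> 0 <= b ->
  logmean 1%:E a b = (a + b) / 2.
Proof.
move=> a0 b0.
apply: (logmean_continuousE _ (fun z => (z.1 + z.2) / 2)) => // [|x y x0 y0].
  by apply: cvgM; [apply: cvgD; [exact: cvg_fst|exact: cvg_snd]|exact: cvg_cst].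
rewrite /=; case: eqVneq => [->|xy]; first by field.
have -> : (1 == -1 :> R) = false.
  by apply/eqP => /eqP; rewrite eq_sym lt_eqF// ltrN10//.
rewrite oner_eq0 invr1 -[1 + 1]/(2%:R) !powR_mulrn ?ltW//.
have ->: (y ^+ 2 - x ^+ 2) / (2 * (y - x)) = (x + y) / 2.
  by field; rewrite subr_eq0 eq_sym.
by rewrite powRr1// ltW// divr_gt0// addr_gt0.
Qed.

Lemma logmean_geometric a b : 0 <= a -> 0 <= b ->
  logmean (- 2)%:E a b = Num.sqrt (a * b).
Proof.
move=> a0 b0.
apply: (logmean_continuousE _ (fun z => Num.sqrt (z.1 * z.2))) => // [|x y x0 y0].
  apply: (continuous_cvg _ (@sqrt_continuous R _)).
  by apply: cvgM; [exact: cvg_fst|exact: cvg_snd].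
rewrite /=; case: eqVneq => [->|xy]; first by rewrite -expr2 sqrtr_sqr gtr0_norm.
have -> : (-2 == -1 :> R) = false by apply/eqP; lra.
have -> : (-2 == 0 :> R) = false by apply/eqP; lra.
have -> : -2 + 1 = -1 :> R by ring.
rewrite !powR_inv1 ?ltW// invrN.
have -> : (y^-1 - x^-1) / (-1 * (y - x)) = (x * y)^-1.
  by field; rewrite (gt_eqF x0) (gt_eqF y0) subr_eq0 eq_sym.
rewrite -powR12_sqrt ?mulr_ge0 ?ltW// -powR_inv1 ?mulr_ge0 ?ltW// -powRrM.
by rewrite mulrNN mul1r.
Qed.

Lemma logmean_heron a b : 0 <= a -> 0 <= b ->
  logmean (- 2^-1)%:E a b = 2^-1 * ((a + b) / 2) + 2^-1 * Num.sqrt (a * b).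
Proof.
move=> a0 b0.
apply: (logmean_continuousE _ (fun z =>
  2^-1 * ((z.1 + z.2) / 2) + 2^-1 * Num.sqrt (z.1 * z.2))) => // [|x y x0 y0].
  apply: cvgD; apply: cvgMr.
    by apply: cvgM; [apply: cvgD; [exact: cvg_fst|exact: cvg_snd]|exact: cvg_cst].
  apply: (continuous_cvg _ (@sqrt_continuous R _)).
  by apply: cvgM; [exact: cvg_fst|exact: cvg_snd].
rewrite /=; case: eqVneq => [->|xy].
  by rewrite -expr2 sqrtr_sqr gtr0_norm//; field.
have -> : (- 2^-1 == -1 :> R) = false by apply/eqP; lra.
have -> : (- 2^-1 == 0 :> R) = false by apply/eqP; lra.
have -> : - 2^-1 + 1 = 2^-1 :> R by field.
rewrite !powR12_sqrt ?ltW// invrN invrK sqrtrM ?ltW//.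
have := sqr_sqrtr (ltW x0); have := sqr_sqrtr (ltW y0).
have : 0 < Num.sqrt x by rewrite sqrtr_gt0.
have : 0 < Num.sqrt y by rewrite sqrtr_gt0.
move: (Num.sqrt x) (Num.sqrt y) => p q q0 p0 qE pE.
have pq : q - p != 0.
  by apply: contra_neq xy => /subr0_eq E; rewrite -pE -qE E.
have pDq : p + q != 0 by rewrite gt_eqF// addr_gt0.
rewrite -qE -pE.
(* Here [p] and [q] are the square roots of [x] and [y]. Raising [2 / (p + q)] to the power -2 gives
   a quarter of [(p + q) ^+ 2], which is the claimed mean. *)
have -> : (q - p) / (2^-1 * (q ^+ 2 - p ^+ 2)) = 2 / (p + q).
  by rewrite subr_sqr; field; rewrite pDq.
rewrite powR_invn ?divr_ge0 ?addr_ge0 ?ltW//.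
by field.
Qed.

End LogMeanLimit.

(** * The cube-root mean between minimum and geometric mean *)

Section HG2.
Context {R : realType}.
Implicit Types p q : R.

(** The cube root of [H * G ^+ 2], with [H = 2 * p * q / (p + q)] the harmonic and [G] the geometric
    mean. *)
Definition hg2_mean p q : R :=
  2 `^ 3^-1 * (p `^ (2 / 3) * q `^ (2 / 3) / (p + q) `^ 3^-1).

Lemma hg2_mean_ge0 p q : 0 <= hg2_mean p q.
Proof. by rewrite !mulr_ge0 ?invr_ge0 ?powR_ge0. Qed.

(** Cubing removes the fractional exponents, so that the comparisons below become polynomial. *)
Lemma hg2_mean_cube p q : 0 <= p -> 0 <= q ->
  hg2_mean p q ^+ 3 = 2 * (p * q) ^+ 2 / (p + q).
Proof.
move=> p0 q0; rewrite /hg2_mean !exprMn exprVn.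
have cube (x r : R) : (x `^ r) ^+ 3 = x `^ (r * 3).
  by rewrite -powR_mulrn ?powR_ge0// -powRrM.
rewrite !cube.
have -> : 3^-1 * 3 = 1 :> R by field.
have -> : 2 / 3 * 3 = 2 :> R by field.
by rewrite !powRr1 ?addr_ge0// !powR_mulrn// mulrA.
Qed.

Lemma min_le_hg2_mean p q : 0 <= p -> 0 <= q -> Num.min p q <= hg2_mean p q.
Proof.
have hg2C x y : hg2_mean x y = hg2_mean y x.
  by rewrite /hg2_mean (mulrC (x `^ _)) (addrC x).
wlog pq : p q / p <= q => [hw p0 q0|p0 q0].
  have /orP[pq|qp] := le_total p q; first exact: hw.
  by rewrite minC hg2C; exact: hw.
rewrite min_l// -(@ler_pXn2r _ 3)// ?nnegrE ?hg2_mean_ge0// hg2_mean_cube//.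
have [pq0|pq0] := eqVneq (p + q) 0.
  by rewrite (_ : p = 0) ?expr0n/= ?mul0r ?expr0n/= ?mulr0 ?mul0r//; lra.
rewrite ler_pdivlMr ?lt0r ?pq0 ?addr_ge0// -subr_ge0.
have -> : 2 * (p * q) ^+ 2 - p ^+ 3 * (p + q) = p ^+ 2 * ((2 * q + p) * (q - p)).
  by ring.
by rewrite !mulr_ge0 ?exprn_ge0 ?subr_ge0 ?addr_ge0 ?mulr_ge0.
Qed.

(** After cubing and clearing the denominator, this is the inequality of arithmetic and geometric
    means, [2 * sqrt (p * q) <= p + q]. *)
Lemma hg2_mean_le_sqrt p q : 0 <= p -> 0 <= q ->
  hg2_mean p q <= Num.sqrt (p * q).
Proof.
move=> p0 q0.
rewrite -(@ler_pXn2r _ 3)// ?nnegrE ?hg2_mean_ge0 ?sqrtr_ge0// hg2_mean_cube//.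
rewrite sqrtrM//.
(* When [p + q = 0] the quotient is 0, because the inverse of 0 is 0. *)
have [pq0|pq0] := eqVneq (p + q) 0.
  by rewrite pq0 invr0 mulr0 exprn_ge0// mulr_ge0 ?sqrtr_ge0.
rewrite ler_pdivrMr ?lt0r ?pq0 ?addr_ge0//.
rewrite -{1 3}(sqr_sqrtr p0) -{1 3}(sqr_sqrtr q0).
have := sqrtr_ge0 q; have := sqrtr_ge0 p.
move: (Num.sqrt p) (Num.sqrt q) => x y x0 y0; rewrite -subr_ge0.
have -> : (x * y) ^+ 3 * (x ^+ 2 + y ^+ 2) - 2 * (x ^+ 2 * y ^+ 2) ^+ 2 =
    (x * y) ^+ 3 * (x - y) ^+ 2 by ring.
by rewrite mulr_ge0 ?sqr_ge0 ?exprn_ge0 ?mulr_ge0.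
Qed.

End HG2.

(** * Integration of the pointwise identities and inequalities *)

Section Integrals.
Context {d : measure_display} {T : measurableType d} {R : realType}.
Variable mu : {measure set T -> \bar R}.
Implicit Types f g p q : T -> R.
Local Open Scope ereal_scope.

(* Unlike [ge0_le_integral], this needs no measurability: the integral of a
   nonnegative function is a supremum over the simple functions below it. *)
Lemma le_integral_fun f g : (forall x, 0 <= f x <= g x)%R ->
  \int[mu]_x (f x)%:E <= \int[mu]_x (g x)%:E.
Proof.
move=> fg.
rewrite !ge0_integralTE => [|x|x]; rewrite ?lee_fin.
- apply: ereal_sup_le => _ [h hf <-]; exists h => // x.
  by apply: (le_trans (hf x)); rewrite lee_fin; have /andP[] := fg x.
- by have /andP[f0] := fg x; exact: le_trans f0.
- by have /andP[] := fg x.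
Qed.

Variables p q : T -> R.
Hypotheses (Op : Omega mu p) (Oq : Omega mu q).
Let mp : measurable_fun [set: T] p. Proof. by case: Op. Qed.
Let mq : measurable_fun [set: T] q. Proof. by case: Oq. Qed.
Let p0 x : (0 <= p x)%R. Proof. by case: Op. Qed.
Let q0 x : (0 <= q x)%R. Proof. by case: Oq. Qed.
Let Ip : \int[mu]_x (p x)%:E = 1. Proof. by case: Op. Qed.
Let Iq : \int[mu]_x (q x)%:E = 1. Proof. by case: Oq. Qed.

Lemma integralD_fun f g :
  measurable_fun [set: T] f -> measurable_fun [set: T] g ->
  (forall x, 0 <= f x)%R -> (forall x, 0 <= g x)%R ->
  \int[mu]_x (f x + g x)%:E = \int[mu]_x (f x)%:E + \int[mu]_x (g x)%:E.
Proof.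
move=> mf mg f0 g0; under eq_integral do rewrite EFinD.
by rewrite ge0_integralD//; do ?[by move=> x _; rewrite lee_fin];
  exact/measurable_EFinP.
Qed.

Lemma integralZ_fun (k : R) f : measurable_fun [set: T] f ->
  (forall x, 0 <= f x)%R -> (0 <= k)%R ->
  \int[mu]_x (k * f x)%:E = k%:E * \int[mu]_x (f x)%:E.
Proof.
move=> mf f0 k0; under eq_integral do rewrite EFinM.
by rewrite ge0_integralZl_EFin//; do ?[by move=> x _; rewrite lee_fin];
  exact/measurable_EFinP.
Qed.

Lemma integral_average : \int[mu]_x ((p x + q x) / 2)%:E = 1.
Proof.
under eq_integral do rewrite mulrC.
rewrite integralZ_fun//; last 2 first.
- exact: measurable_funD.
- by move=> x; rewrite addr_ge0.
by rewrite integralD_fun// Ip Iq -EFinD -EFinM mulVf.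
Qed.

Let mabs : measurable_fun [set: T] (fun x => `|p x - q x|%R).
Proof. by apply: measurableT_comp => //; exact: measurable_funB. Qed.

Let half_Dv : \int[mu]_x (2^-1 * `|p x - q x|%R)%:E = (2^-1)%:E * D_v mu p q.
Proof. by rewrite integralZ_fun. Qed.

Lemma integral_max :
  \int[mu]_x (Num.max (p x) (q x))%:E = 1 + (2^-1)%:E * D_v mu p q.
Proof.
rewrite -integral_average -half_Dv -integralD_fun.
- by apply: eq_integral => x _; congr EFin; rewrite maxr_absE; field.
- apply: measurable_funM => //; exact: measurable_funD.
- by apply: measurable_funM.
- by move=> x; rewrite divr_ge0// addr_ge0.
- by move=> x; rewrite mulr_ge0.
Qed.

(** The identity is first obtained as a sum, because subtraction of extended reals cancels only
    finite terms. Half the variation distance is finite, being at most the whole sum, which is 1. *)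
Lemma integral_min :
  \int[mu]_x (Num.min (p x) (q x))%:E = 1 - (2^-1)%:E * D_v mu p q.
Proof.
have E : \int[mu]_x (Num.min (p x) (q x))%:E + (2^-1)%:E * D_v mu p q = 1.
  rewrite -integral_average -half_Dv -integralD_fun.
  - by apply: eq_integral => x _; congr EFin; rewrite minr_absE; field.
  - exact: measurable_minr.
  - by apply: measurable_funM.
  - by move=> x; rewrite le_min p0 q0.
  - by move=> x; rewrite mulr_ge0.
rewrite -E addeK//.
have m0 : 0 <= \int[mu]_x (Num.min (p x) (q x))%:E.
  by apply: integral_ge0 => x _; rewrite lee_fin le_min p0 q0.
have D0 : 0 <= (2^-1)%:E * D_v mu p q.
  by rewrite -half_Dv; apply: integral_ge0 => x _; rewrite lee_fin mulr_ge0.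
rewrite ge0_fin_numE// (@le_lt_trans _ _ 1)// ?ltry//.
by rewrite -E leeDr.
Qed.

Lemma D_logmean_le u s : u <= s -> D_logmean mu u p q <= D_logmean mu s p q.
Proof.
move=> us; apply: le_integral_fun => x; rewrite logmean_le// andbT.
(* Nonnegativity comes from the order [-oo], where the mean is a minimum of densities. *)
apply: (@le_trans _ _ (logmean -oo (p x) (q x))); last first.
  exact: logmean_le (leNye _) _ _.
by rewrite logmeanNy// le_min p0 q0.
Qed.

Lemma D_logmeanNy : D_logmean mu -oo p q = 1 - (2^-1)%:E * D_v mu p q.
Proof.
by rewrite -integral_min; apply: eq_integral => x _; rewrite logmeanNy.
Qed.

Lemma D_logmeany : D_logmean mu +oo p q = 1 + (2^-1)%:E * D_v mu p q.
Proof.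
by rewrite -integral_max; apply: eq_integral => x _; rewrite logmeany.
Qed.

Lemma D_logmean_arithmetic : D_logmean mu 1%:E p q = 1.
Proof.
rewrite -[RHS]integral_average.
by apply: eq_integral => x _; rewrite logmean_arithmetic.
Qed.

Lemma D_logmean_geometric : D_logmean mu (- 2)%:E p q = D_B mu p q.
Proof. by apply: eq_integral => x _; rewrite logmean_geometric. Qed.

Let msqrt : measurable_fun [set: T] (fun x => Num.sqrt (p x * q x)).
Proof.
apply: measurableT_comp; last exact: measurable_funM.
exact: continuous_measurable_fun (@sqrt_continuous R).
Qed.

Lemma D_logmean_heron :
  D_logmean mu (- 2^-1)%:E p q = (2^-1)%:E + (2^-1)%:E * D_B mu p q.
Proof.
have mavg : measurable_fun [set: T] (fun x => (p x + q x) / 2)%R.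
  by apply: measurable_funM => //; exact: measurable_funD.
have avg0 x : (0 <= (p x + q x) / 2)%R by rewrite divr_ge0// addr_ge0.
rewrite -[X in X + _]mule1 -integral_average -!integralZ_fun// -integralD_fun.
- by apply: eq_integral => x _; rewrite logmean_heron.
- exact: measurable_funM.
- exact: measurable_funM.
- by move=> x; rewrite mulr_ge0.
- by move=> x; rewrite mulr_ge0 ?sqrtr_ge0.
Qed.

Lemma D_HG2E : D_HG2 mu p q = \int[mu]_x (hg2_mean (p x) (q x))%:E.
Proof.
rewrite /D_HG2 /hg2_mean integralZ_fun ?powR_ge0// => [|x]; last first.
  by rewrite !mulr_ge0 ?invr_ge0 ?powR_ge0.
(* Turning the quotient into a product with a power of negative exponent reduces measurability to
   that of powers. *)
under eq_fun do rewrite -powRN.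
apply: measurable_funM; first apply: measurable_funM.
- exact: measurableT_comp (measurable_powR _) mp.
- exact: measurableT_comp (measurable_powR _) mq.
- exact: measurableT_comp (measurable_powR _) (measurable_funD mp mq).
Qed.

End Integrals.

(** * The two chains of inequalities *)

Local Open Scope ereal_scope.

Theorem theorem1 (R : realType) (d : measure_display) (T : measurableType d)
    (mu : {sigma_finite_measure set T -> \bar R}) :
  (forall q r : T -> R, Omega mu q -> Omega mu r ->
   forall u s : \bar R, u < s ->
     [/\ 1 - (2^-1)%:E * D_v mu r q <= D_logmean mu u r q,
         D_logmean mu u r q <= D_logmean mu s r q &
         D_logmean mu s r q <= 1 + (2^-1)%:E * D_v mu r q])
  /\
  (forall p q : T -> R, Omega mu p -> Omega mu q ->
     [/\ 1 - (2^-1)%:E * D_v mu p q <= D_HG2 mu p q,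
         D_HG2 mu p q <= D_B mu p q &
         D_B mu p q <= D_L mu p q] /\
     [/\ D_L mu p q <= (2^-1)%:E + (2^-1)%:E * D_B mu p q,
         (2^-1)%:E + (2^-1)%:E * D_B mu p q <= D_I mu p q &
         D_I mu p q <= 1]).
Proof.
split=> [q r Oq Or u s us|p q Op Oq].
  rewrite -(D_logmeanNy mu r q Or Oq) -(D_logmeany mu r q Or Oq).
  by split; apply: D_logmean_le => //; [exact: leNye|exact: ltW|exact: leey].
have [_ p0 _] := Op; have [_ q0 _] := Oq.
have D_le (u s : R) : (u <= s)%R -> D_logmean mu u%:E p q <= D_logmean mu s%:E p q.
  by move=> us; apply: D_logmean_le => //; rewrite lee_fin.
rewrite -(D_logmean_heron mu p q Op Oq) -(D_logmean_geometric mu p q Op Oq).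
split; split.
(* The cube-root mean is given no order [t]; it is compared pointwise with the minimum here and with
   the geometric mean next. *)
- rewrite -(integral_min mu p q Op Oq) (D_HG2E mu p q Op Oq).
  by apply: le_integral_fun => x; rewrite le_min p0 q0 min_le_hg2_mean.
- rewrite (D_HG2E mu p q Op Oq) (D_logmean_geometric mu p q Op Oq).
  by apply: le_integral_fun => x; rewrite hg2_mean_ge0 hg2_mean_le_sqrt.
- by apply: D_le; rewrite lerN2 ler1n.
- by apply: D_le; rewrite lerN2 invf_le1// ler1n.
- by apply: D_le; rewrite oppr_le0 invr_ge0.
- rewrite -[X in _ <= X](D_logmean_arithmetic mu p q Op Oq).
  by apply: D_le; rewrite ler01.
Qed.
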